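(* For any fixed $(x,y)\in\mathcal{X}$, the worst-case expectation problem $\sup_{\mathbb{P}\in\mathcal{F}(\mathcal{S},\mu,\eta)}\mathbb{E}_{\mathbb{P}}[Q(x,W)]$ is equivalent (has the same optimal value) to $$\min_{\rho,\ \psi\ge 0}\ \Big\{\sum_{t\in T}\sum_{i\in I}(\mu_{i,t}\rho_{i,t}+\eta_{i,t}\psi_{i,t})+\max_{W\in\mathcal{S}}\Big\{Q(x,W)+\sum_{t\in T}\sum_{i\in I}-\big(W_{i,t}\rho_{i,t}+|W_{i,t}-\mu_{i,t}|\psi_{i,t}\big)\Big\}\Big\},$$ where $\rho=(\rho_{i,t})\in\mathbb{R}^{I\times T}$ is unrestricted in sign and $\psi=(\psi_{i,t})\in\mathbb{R}^{I\times T}$ satisfies $\psi\ge 0$ componentwise.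
   Context: Let $I$ (customers), $J$ (candidate locations), $M$ (mobile facilities) be finite nonempty index sets and $T=\{1,\dots,|T|\}$ a finite set of time periods. Data: distances $d_{i,j}\ge 0$, travel times $t_{j,j'}\in\mathbb{Z}_{\ge 0}$, assignment cost factor $\beta\ge 0$, capacity $C\ge 0$, unmet-demand penalty $\gamma\ge 0$. The first-stage feasible region $\mathcal{X}$ is the set of all $(x,y)$ with $x_{j,m}^t\in\{0,1\}$, $y_m\in\{0,1\}$ for all $j\in J,m\in M,t\in T$, such that $x_{j,m}^t+x_{j',m}^{t'}\le y_m$ for all $t\in T$, $m\in M$, $j,j'\in J$ with $j\ne j'$, and $t'\in\{t,\dots,\min\{t+t_{j,j'},|T|\}\}$. For $(x,y)\in\mathcal{X}$ and a demand realization $W=(W_{i,t})_{i\in I,t\in T}\ge 0$, the recourse function is $$Q(x,W)=\min_{z,u}\ \sum_{j\in J}\sum_{i\in I}\sum_{m\in M}\sum_{t\in T}\beta d_{i,j}z_{i,j,m}^t+\gamma\sum_{t\in T}\sum_{i\in I}u_{i,t}$$ subject to $\sum_{j\in J}\sum_{m\in M}z_{i,j,m}^t+u_{i,t}=W_{i,t}$ for all $i\in I,t\in T$; $\sum_{i\in I}z_{i,j,m}^t\le C x_{j,m}^t$ for all $j\in J,m\in M,t\in T$; $u_{i,t}\ge 0$, $z_{i,j,m}^t\ge 0$ for all $i,j,m,t$. The support is $\mathcal{S}=\{W\ge 0:\ \underline{W}_{i,t}\le W_{i,t}\le\overline{W}_{i,t}\ \forall i\in I,t\in T\}$, with given bounds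 $0\le\underline{W}_{i,t}\le\overline{W}_{i,t}<\infty$; it is nonempty, convex and compact. Given a mean vector $\mu=(\mu_{i,t})\in\mathcal{S}$ and mean-absolute-deviation values $\eta=(\eta_{i,t})$, $\eta_{i,t}\ge 0$, the ambiguity set $\mathcal{F}(\mathcal{S},\mu,\eta)$ is the set of all probability distributions $\mathbb{P}$ of the random vector $W$ supported on $\mathcal{S}$ (i.e. $\mathbb{P}(W\in\mathcal{S})=1$) with $\mathbb{E}_{\mathbb{P}}[W_{i,t}]=\mu_{i,t}$ and $\mathbb{E}_{\mathbb{P}}[|W_{i,t}-\mu_{i,t}|]\le\eta_{i,t}$ for all $i\in I,t\in T$. *)

(* Defs.v *)
From HB Require Import structures.
From mathcomp Require Import all_boot all_order all_algebra.
From mathcomp Require Import all_classical all_reals all_analysis.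

Set Implicit Arguments.
Unset Strict Implicit.
Unset Printing Implicit Defensive.

Import Order.TTheory GRing.Theory Num.Theory.
Import numFieldNormedType.Exports.

Local Open Scope classical_set_scope.
Local Open Scope ring_scope.

(* The customers, locations, facilities and periods are 'I_nI, 'I_nJ, 'I_nM and
   'I_nT.  Periods are numbered from 0, and vectors indexed by customers and
   periods are matrices with one row per customer. *)

Definition is_minimum (disp : Order.disp_t) (V : porderType disp)
    (A : set V) (v : V) : Prop :=
  A v /\ lbound A v.

(* The upper bound min(t + travel j j', last period) on t' reduces to
   t + travel j j', as t' ranges over 'I_nT. *)
Definition first_stage_feasible (nJ nM nT : nat) (travel : 'I_nJ -> 'I_nJ -> nat)
    (x : 'I_nJ -> 'I_nM -> 'I_nT -> bool) (y : 'I_nM -> bool) : Prop :=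
  forall (t : 'I_nT) (m : 'I_nM) (j j' : 'I_nJ) (t' : 'I_nT),
    j != j' -> (t <= t' <= t + travel j j')%N ->
    (x j m t + x j' m t' <= y m)%N.

Definition recourse_feasible (R : realType) (nI nJ nM nT : nat) (C : R)
    (x : 'I_nJ -> 'I_nM -> 'I_nT -> bool) (W : 'M[R]_(nI, nT))
    (z : 'I_nI -> 'I_nJ -> 'I_nM -> 'I_nT -> R) (u : 'M[R]_(nI, nT)) : Prop :=
  [/\ forall i t, \sum_(j < nJ) \sum_(m < nM) z i j m t + u i t = W i t,
      forall j m t, \sum_(i < nI) z i j m t <= C * (x j m t)%:R,
      forall i t, 0 <= u i t
    & forall i j m t, 0 <= z i j m t].

Definition recourse_cost (R : realType) (nI nJ nM nT : nat) (beta gamma : R)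
    (d : 'I_nI -> 'I_nJ -> R)
    (z : 'I_nI -> 'I_nJ -> 'I_nM -> 'I_nT -> R) (u : 'M[R]_(nI, nT)) : R :=
  \sum_(j < nJ) \sum_(i < nI) \sum_(m < nM) \sum_(t < nT)
     beta * d i j * z i j m t
  + gamma * \sum_(t < nT) \sum_(i < nI) u i t.

Definition recourse_values (R : realType) (nI nJ nM nT : nat) (beta gamma C : R)
    (d : 'I_nI -> 'I_nJ -> R) (x : 'I_nJ -> 'I_nM -> 'I_nT -> bool)
    (W : 'M[R]_(nI, nT)) : set R :=
  [set c | exists z u, recourse_feasible C x W z u /\
                       c = recourse_cost beta gamma d z u].

(* The optimal value Q(x, W).  The real infimum is proper for every W >= 0
   (lemma recourse_has_inf); for other W the program is infeasible and the
   value is the irrelevant default 0. *)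
Definition recourse (R : realType) (nI nJ nM nT : nat) (beta gamma C : R)
    (d : 'I_nI -> 'I_nJ -> R) (x : 'I_nJ -> 'I_nM -> 'I_nT -> bool)
    (W : 'M[R]_(nI, nT)) : R :=
  inf (recourse_values beta gamma C d x W).

Lemma recourse_has_inf (R : realType) (nI nJ nM nT : nat) (beta gamma C : R)
    (d : 'I_nI -> 'I_nJ -> R) (x : 'I_nJ -> 'I_nM -> 'I_nT -> bool)
    (W : 'M[R]_(nI, nT)) :
  (forall i j, 0 <= d i j) -> 0 <= beta -> 0 <= C -> 0 <= gamma ->
  (forall i t, 0 <= W i t) ->
  has_inf (recourse_values beta gamma C d x W).
Proof.
move=> d0 beta0 C0 gamma0 W0; split.
  exists (recourse_cost beta gamma d (fun _ _ (_ : 'I_nM) _ => 0) W).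
  exists (fun _ _ _ _ => 0), W; split => //; split => //.
  - move=> i t; rewrite big1 ?add0r// => j _; rewrite big1//.
  - by move=> j m t; rewrite big1// mulr_ge0.
exists 0 => _ [z [u [[_ _ u0 z0] ->]]]; apply: addr_ge0.
  do 4 (apply: sumr_ge0 => ? _).
  by rewrite !mulr_ge0.
by apply: mulr_ge0 => //; do 2 (apply: sumr_ge0 => ? _).
Qed.

Definition demand_support (R : realType) (nI nT : nat) (Wlo Whi : 'M[R]_(nI, nT)) :
    set 'M[R]_(nI, nT) :=
  [set W | forall i t, 0 <= W i t /\ Wlo i t <= W i t <= Whi i t].

(* R^(I x T) with its Borel sigma-algebra. *)
Definition demand_space (R : realType) (nI nT : nat) :=
  g_sigma_algebraType (@open 'M[R]_(nI, nT)).

Definition ambiguity_set (R : realType) (nI nT : nat)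
    (S : set 'M[R]_(nI, nT)) (mu eta : 'M[R]_(nI, nT)) :
    set (probability (demand_space R nI nT) R) :=
  [set P : probability (demand_space R nI nT) R | [/\ P S = 1%E,
      forall i t, 'E_P[fun W : 'M[R]_(nI, nT) => W i t]%E = (mu i t)%:E
    & forall i t, ('E_P[fun W : 'M[R]_(nI, nT) => `|W i t - mu i t|%R]
                     <= (eta i t)%:E)%E]].

Definition worst_case_expectation (R : realType) (nI nT : nat)
    (S : set 'M[R]_(nI, nT)) (mu eta : 'M[R]_(nI, nT))
    (Q : 'M[R]_(nI, nT) -> R) : \bar R :=
  ereal_sup [set 'E_P[Q]%E | P in ambiguity_set S mu eta].

Definition inner_objective (R : realType) (nI nT : nat) (mu : 'M[R]_(nI, nT))
    (Q : 'M[R]_(nI, nT) -> R) (rho psi : 'M[R]_(nI, nT))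
    (W : 'M[R]_(nI, nT)) : R :=
  Q W + \sum_(t < nT) \sum_(i < nI)
          - (W i t * rho i t + `|W i t - mu i t| * psi i t).

Definition dual_objective (R : realType) (nI nT : nat)
    (S : set 'M[R]_(nI, nT)) (mu eta : 'M[R]_(nI, nT))
    (Q : 'M[R]_(nI, nT) -> R) (rho psi : 'M[R]_(nI, nT)) : \bar R :=
  ((\sum_(t < nT) \sum_(i < nI) (mu i t * rho i t + eta i t * psi i t))%:E
   + ereal_sup [set (inner_objective mu Q rho psi W)%:E | W in S])%E.

(* Main.v *)
Require Import Defs.
From HB Require Import structures.
From mathcomp Require Import all_boot all_order all_algebra.
From mathcomp Require Import all_classical all_reals all_analysis.
From mathcomp Require Import measurable_realfun.
From mathcomp Require Import ring lra.

Set Implicit Arguments.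
Unset Strict Implicit.
Unset Printing Implicit Defensive.

Import Order.TTheory GRing.Theory Num.Theory.
Import numFieldNormedType.Exports.

Local Open Scope classical_set_scope.
Local Open Scope ring_scope.

(** Both weak and strong duality rest on the fact that [Q] is Lipschitz.

    The function [Q] is nondecreasing, and serving an additional unit of demand
    costs at most the penalty [gamma] of leaving it unmet; hence [Q] is
    [gamma]-Lipschitz for the l1 distance on the nonnegative orthant
    ([recourse_lipschitz]).  In particular it is continuous on the compact box
    [S], so every inner maximum is attained ([inner_objective_max]), and it is
    Borel measurable.  Weak duality is the integration over [S] of the pointwise
    bound [Q W <= c + sum (W rho + |W - mu| psi)] ([weak_duality]).

    For strong duality, call [v] a perturbation of the right-hand sides of the
    mean and deviation constraints, and relax the perturbed problem by charging
    violations instead of forbidding them: over finitely supported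
    distributions on [S], with expectation [E], let [f v] be the infimum of
    [moment_penalty E v - E Q], in which an error in a mean costs [2 gamma] per
    unit and an excess of a deviation costs [gamma] per unit.  Because
    violations are only charged, [f] is finite everywhere, and it is convex, so
    it has a subgradient [l] at [0], without any constraint qualification
    ([convex_subgradient]).  This matters since [mu] may lie on the boundary of
    [S] and entries of [eta] may vanish.

    The penalty is exact: [- f 0] is at most the worst-case expectation
    ([penalized_le_worst_case]).  A distribution that violates the moment
    constraints is repaired one coordinate at a time, first by contracting the
    demand towards a bound of its interval until the mean is right, then by
    contracting it towards the mean until the deviation is small enough.  The
    l1 distance travelled, times [gamma], is at most the penalty
    ([moment_repair]), so by the Lipschitz property the expectation of [Q]
    drops by no more.

    Finally the Dirac mass at [W] meets the constraints perturbed by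
    [(W - mu, |W - mu| - eta)] exactly, so the subgradient inequality there
    reads [Q W + l (W - mu, |W - mu| - eta) <= - f 0]: the coefficients of
    [- l] are the optimal [rho] and [psi] ([strong_duality]).  The sign of [psi]
    comes from [f] being nonincreasing in the deviation perturbation. *)

(** * Subgradients of finite convex functions *)

(** Convexity of a function defined on a whole vector space. *)
Definition convex_fun (R : realType) (V : lmodType R) (f : V -> R) : Prop :=
  forall (t : R) x y, 0 <= t <= 1 ->
    f (t *: x + (1 - t) *: y) <= t * f x + (1 - t) * f y.

(** A partial infimum of a jointly convex family is convex: [A x] is the set of
    values over which the infimum is taken at [x]. *)
Lemma convex_inf (R : realType) (V : lmodType R) (A : V -> set R) :
  (forall x, has_inf (A x)) ->
  (forall (t : R) x y a b, 0 <= t <= 1 -> A x a -> A y b ->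
     exists2 c, A (t *: x + (1 - t) *: y) c & c <= t * a + (1 - t) * b) ->
  convex_fun (fun x => inf (A x)).
Proof.
move=> Ainf Acvx t x y t01; apply/ler_addgt0Pr => e e0.
have [a Aa ae] := inf_adherent e0 (Ainf x).
have [b Ab be] := inf_adherent e0 (Ainf y).
have [c Ac cab] := Acvx t x y a b t01 Aa Ab.
apply: le_trans (ge_inf (Ainf _).2 Ac) _; apply: le_trans cab _.
have /andP[t0 t1] := t01; nra.
Qed.

Section subgradient.
Variables (R : realType) (V : lmodType R).
Implicit Types (f : V -> R) (e x : V).

(** The infimum of the right difference quotients at [0] in direction [e] is a
    slope that supports [f] on the whole line. *)
Lemma convex_line_slope f e : convex_fun f ->
  exists s, forall a : R, f 0 + a * s <= f (a *: e).
Proof.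
move=> fcvx.
have slopes (a b : R) : 0 < a -> 0 < b ->
    (f 0 - f (- b *: e)) / b <= (f (a *: e) - f 0) / a.
  move=> a0 b0; have ab0 : 0 < a + b by exact: addr_gt0.
  have t01 : 0 <= b / (a + b) <= 1.
    apply/andP; split; first by rewrite divr_ge0 // ltW.
    by rewrite ler_pdivrMr// mul1r lerDr ltW.
  have := fcvx _ (a *: e) (- b *: e) t01.
  rewrite !scalerA -scalerDl.
  have -> : b / (a + b) * a + (1 - b / (a + b)) * - b = 0 by field; rewrite gt_eqF.
  rewrite scale0r => h.
  rewrite ler_pdivrMr// mulrAC ler_pdivlMr//.
  have : (a + b) * f 0 <= b * f (a *: e) + a * f (- b *: e).
    apply: le_trans (ler_wpM2l (ltW ab0) h) _.
    by rewrite le_eqVlt; apply/orP; left; apply/eqP; field; rewrite gt_eqF.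
  lra.
pose D := [set s | exists2 a : R, 0 < a & s = (f (a *: e) - f 0) / a].
have Dinf : has_inf D.
  split; first by exists ((f (1 *: e) - f 0) / 1), 1.
  exists ((f 0 - f (- 1 *: e)) / 1) => _ [a a0 ->]; exact: slopes.
exists (inf D) => a; have [a0|a0|->] := ltgtP a 0.
- have na0 : 0 < - a by rewrite oppr_gt0.
  have : (f 0 - f (a *: e)) / - a <= inf D.
    apply: lb_le_inf; first exact: Dinf.1.
    by move=> _ [b b0 ->]; have := slopes _ _ b0 na0; rewrite opprK.
  rewrite ler_pdivrMr//; lra.
- have : inf D <= (f (a *: e) - f 0) / a by apply: (ge_inf Dinf.2); exists a.
  rewrite ler_pdivlMr//; lra.
- by rewrite mul0r addr0 scale0r.
Qed.

(** One direction is treated at a time: minimizing [f - s] along the last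
    direction, [s] its supporting slope, leaves a convex function with the same
    value at [0], to which the induction hypothesis applies. *)
Lemma convex_family_slopes n (e : nat -> V) f : convex_fun f ->
  exists c : nat -> R, forall a : nat -> R,
    f 0 + \sum_(k < n) a k * c k <= f (\sum_(k < n) a k *: e k).
Proof.
elim: n f => [|n IH] f fcvx.
  by exists (fun=> 0) => a; rewrite !big_ord0 addr0.
have [s sP] := convex_line_slope (e n) fcvx.
pose A x := [set r | exists b : R, r = f (x + b *: e n) - b * s].
have Ainf x : has_inf (A x).
  split; first by exists (f (x + 0 *: e n) - 0 * s), 0.
  (* [(b / 2) e] is the midpoint of [x + b e] and [- x]. *)
  exists (2 * f 0 - f (- x)) => _ [b ->].
  have half : 0 <= (2^-1 : R) <= 1 by lra.
  have := fcvx _ (x + b *: e n) (- x) half.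
  have -> : 2^-1 *: (x + b *: e n) + (1 - 2^-1) *: - x = (b / 2) *: e n.
    have -> : 1 - 2^-1 = 2^-1 :> R by lra.
    by rewrite -scalerDr addrAC subrr add0r scalerA mulrC.
  have := sP (b / 2); lra.
have Acvx : convex_fun (fun x => inf (A x)).
  apply: convex_inf => // t x y _ _ t01 [b1 ->] [b2 ->].
  exists (f (t *: x + (1 - t) *: y + (t * b1 + (1 - t) * b2) *: e n)
          - (t * b1 + (1 - t) * b2) * s); first by eexists.
  have := fcvx t (x + b1 *: e n) (y + b2 *: e n) t01.
  rewrite !scalerDr !scalerA addrACA -scalerDl; lra.
have A0 : inf (A 0) = f 0.
  apply/eqP; rewrite eq_le; apply/andP; split.
    by apply: (ge_inf (Ainf 0).2); exists 0; rewrite scale0r addr0 mul0r subr0.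
  apply: lb_le_inf; first exact: (Ainf 0).1.
  by move=> _ [b ->]; rewrite add0r; have := sP b; lra.
have [c cP] := IH _ Acvx.
exists (fun k => if (k < n)%N then c k else s) => a.
rewrite !big_ord_recr/= ltnn.
under eq_bigr do rewrite ltn_ord.
have := cP a; rewrite A0.
have : inf (A (\sum_(k < n) a k *: e k)) <=
    f (\sum_(k < n) a k *: e k + a n *: e n) - a n * s.
  by apply: (ge_inf (Ainf _).2); exists (a n).
lra.
Qed.

End subgradient.

Lemma convex_subgradient (R : realType) (V : vectType R) (f : V -> R) :
  convex_fun f -> exists l : {scalar V}, forall x, f 0 + l x <= f x.
Proof.
move=> fcvx.
pose b := vbasis {:V}.
have [c cP] := convex_family_slopes (\dim {:V}) (fun k => b`_k) fcvx.
pose l x := \sum_(k < \dim {:V}) c k * coord b k x.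
have lin : scalar l.
  move=> a x y; rewrite /l mulr_sumr -big_split/=; apply: eq_bigr => k _.
  rewrite linearP/=; ring.
pose L := GRing.isLinear.Build R V R *%R l lin.
pose lL : {scalar V} := HB.pack l L.
exists lL => x; rewrite /= /l.
pose a k := if insub k is Some i then coord b i x else 0.
have aE (k : 'I_(\dim {:V})) : a k = coord b k x by rewrite /a valK.
have := cP a.
rewrite (eq_bigr (fun k : 'I__ => c k * coord b k x)); last first.
  by move=> k _; rewrite aE mulrC.
rewrite [X in _ <= f X](eq_bigr (fun k : 'I__ => coord b k x *: b`_k)); last first.
  by move=> k _; rewrite aE.
by rewrite -coord_vbasis ?memvf.
Qed.

(** * Finitely supported distributions *)

(** [fin_mean S E] says that [E] is the expectation under a finitely supported
    distribution on [S]; these functionals are generated by the evaluations at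
    the points of [S] under binary convex combinations. *)
Inductive fin_mean (R : realType) (X : Type) (S : set X) :
    ((X -> R) -> R) -> Prop :=
| fin_mean_dirac x : S x -> fin_mean S (fun f => f x)
| fin_mean_mix (t : R) E F : 0 <= t <= 1 -> fin_mean S E -> fin_mean S F ->
    fin_mean S (fun f => t * E f + (1 - t) * F f).

Section fin_mean_theory.
Variables (R : realType) (X : Type) (S : set X) (E : (X -> R) -> R).
Hypothesis meanE : fin_mean S E.
Implicit Types f g : X -> R.

Lemma fin_meanD f g : E (fun x => f x + g x) = E f + E g.
Proof. by elim: meanE => [//|t E1 F _ _ -> _ ->]; ring. Qed.

Lemma fin_meanZ a f : E (fun x => a * f x) = a * E f.
Proof. by elim: meanE => [//|t E1 F _ _ -> _ ->]; ring. Qed.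

Lemma fin_mean_cst a : E (fun=> a) = a.
Proof. by elim: meanE => [//|t E1 F _ _ -> _ ->]; ring. Qed.

Lemma fin_mean_affine a b f : E (fun x => a + b * f x) = a + b * E f.
Proof. by rewrite fin_meanD fin_mean_cst fin_meanZ. Qed.

Lemma fin_mean_sum (I : Type) (r : seq I) (P : pred I) (F : I -> X -> R) :
  E (fun x => \sum_(i <- r | P i) F i x) = \sum_(i <- r | P i) E (F i).
Proof.
elim: meanE => [//|t E1 G _ _ -> _ ->].
by rewrite big_split/= !mulr_sumr.
Qed.

Lemma le_fin_mean f g : (forall x, S x -> f x <= g x) -> E f <= E g.
Proof.
move=> fg; elim: meanE => [x /fg//|t E1 F t01 _ Efg _ Ffg].
have /andP[t0 t1] := t01; apply: lerD; apply: ler_wpM2l => //.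
by rewrite subr_ge0.
Qed.

Lemma eq_fin_mean f g : (forall x, S x -> f x = g x) -> E f = E g.
Proof.
by move=> fg; apply/eqP; rewrite eq_le !le_fin_mean// => x /fg ->.
Qed.

(** The push-forward of a finitely supported distribution. *)
Lemma fin_mean_comp (Y : Type) (S' : set Y) (T : X -> Y) :
  (forall x, S x -> S' (T x)) -> fin_mean S' (fun f : Y -> R => E (f \o T)).
Proof.
move=> TS; elim: meanE => [x /TS|t E1 F t01 _ hE _ hF].
  exact: (@fin_mean_dirac _ _ S' (T x)).
exact: (fin_mean_mix t01 hE hF).
Qed.

End fin_mean_theory.

Section mix_probability.
Context d (T : measurableType d) (R : realType).
Variables (p q : {nonneg R}) (pq1 : p%:num + q%:num = 1 :> R).
Variables (P1 P2 : probability T R).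

(** The mixture of [P1] and [P2] with weights [p] and [q]; the proof that the
    weights sum to one is an argument so that the mixture is canonically a
    probability. *)
Definition mix_measure of p%:num + q%:num = 1 :> R :=
  measure_add (mscale p P1) (mscale q P2).

HB.instance Definition _ := Measure.on (mix_measure pq1).

Let mix_measure_setT : mix_measure pq1 [set: T] = 1%E.
Proof.
rewrite /mix_measure measure_addE/= /mscale/= !probability_setT !mule1.
by rewrite -EFinD pq1.
Qed.

HB.instance Definition _ :=
  Measure_isProbability.Build _ _ _ (mix_measure pq1) mix_measure_setT.

Lemma ge0_integral_mix (f : T -> \bar R) : measurable_fun setT f ->
  (forall x, 0 <= f x)%E ->
  (\int[mix_measure pq1]_x f x =
   p%:num%:E * \int[P1]_x f x + q%:num%:E * \int[P2]_x f x)%E.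
Proof.
move=> mf f0.
by rewrite /mix_measure ge0_integral_measure_add// !ge0_integral_mscale.
Qed.

End mix_probability.

Section fin_mean_probability.
Context d (T : measurableType d) (R : realType) (S : set T).

Lemma fin_mean_ge0_integral (E : (T -> R) -> R) : fin_mean S E ->
  exists P : probability T R, forall f : T -> R, measurable_fun setT f ->
    (forall x, 0 <= f x) -> (\int[P]_x (f x)%:E = (E f)%:E)%E.
Proof.
elim=> [x Sx|t {}E F t01 _ [P PE] _ [P' P'F]].
  exists (dirac x) => f mf f0.
  by rewrite integral_dirac// ?diracT ?mul1e//; exact/measurable_EFinP.
have /andP[t0 t1] := t01; have q0 : 0 <= 1 - t by rewrite subr_ge0.
have pq1 : (NngNum t0)%:num + (NngNum q0)%:num = 1 :> R by rewrite /= addrC subrK.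
exists (mix_measure P P' pq1) => f mf f0.
rewrite ge0_integral_mix//; last exact/measurable_EFinP.
by rewrite PE// P'F.
Qed.

(** Every finitely supported expectation is the integral against an actual
    probability measure. *)
Lemma fin_mean_probability (E : (T -> R) -> R) : measurable S -> fin_mean S E ->
  exists P : probability T R, P S = 1%E /\
    forall f : T -> R, measurable_fun setT f -> 'E_P[f]%E = (E f)%:E.
Proof.
move=> mS hE; have [P PE] := fin_mean_ge0_integral hE.
exists P; split=> [|f mf].
  rewrite -[S]setIT -integral_indic// PE//.
  rewrite (@eq_fin_mean _ _ _ _ hE _ (fun=> 1)) ?(fin_mean_cst hE)//.
  by move=> x Sx; rewrite indicE mem_set.
rewrite unlock integralE.
rewrite -/(EFin \o f) funerpos funerneg !PE//; first last.
- exact: measurable_funrpos.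
- exact: measurable_funrneg.
rewrite -EFinB -mulN1r -(fin_meanZ hE) -(fin_meanD hE); congr (E _)%:E.
by apply/funext => x; rewrite mulN1r -[in RHS](funrposBneg f).
Qed.

End fin_mean_probability.

(** * Repairing the mean and the mean absolute deviation *)

Section repair.
Variables (R : realType) (X : Type) (S : set X) (E : (X -> R) -> R).
Hypothesis meanE : fin_mean S E.
Variables (lo hi mu : R).
Hypothesis mu_itv : lo <= mu <= hi.
Implicit Types (w : X -> R) (h : R -> R).

(** A map of the interval into itself moves the mean of [w] to [mu], at an
    expected displacement equal to the error in the mean.  It is a contraction
    towards the end of the interval that lies beyond [mu], seen from the mean
    of [w]. *)
Lemma mean_recenter w : (forall x, S x -> lo <= w x <= hi) ->
  exists h, [/\ forall z, lo <= z <= hi -> lo <= h z <= hi,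
    E (fun x => h (w x)) = mu &
    E (fun x => `|h (w x) - w x|) <= `|E w - mu| ].
Proof.
move=> w_itv; have /andP[lomu muhi] := mu_itv.
have [mltmu|mgtmu|mmu] := ltgtP (E w) mu.
- have d0 : 0 < hi - E w by lra.
  pose r := (hi - mu) / (hi - E w).
  have r0 : 0 <= r by apply: divr_ge0; lra.
  have r1 : r <= 1 by rewrite ler_pdivrMr// mul1r; lra.
  have rE : r * (hi - E w) = hi - mu by rewrite divfK// gt_eqF.
  exists (fun z => (1 - r) * hi + r * z); split.
  + by move=> z /andP[z0 z1]; apply/andP; split; nra.
  + rewrite /= (fin_mean_affine meanE); lra.
  + rewrite (@eq_fin_mean _ _ _ _ meanE _
      (fun x => (1 - r) * hi + (r - 1) * w x)); last first.
      by move=> x /w_itv/andP[w0 w1]; rewrite ger0_norm; nra.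
    rewrite (fin_mean_affine meanE) ltr0_norm; lra.
- have d0 : 0 < E w - lo by lra.
  pose r := (mu - lo) / (E w - lo).
  have r0 : 0 <= r by apply: divr_ge0; lra.
  have r1 : r <= 1 by rewrite ler_pdivrMr// mul1r; lra.
  have rE : r * (E w - lo) = mu - lo by rewrite divfK// gt_eqF.
  exists (fun z => (1 - r) * lo + r * z); split.
  + by move=> z /andP[z0 z1]; apply/andP; split; nra.
  + rewrite /= (fin_mean_affine meanE); lra.
  + rewrite (@eq_fin_mean _ _ _ _ meanE _
      (fun x => (r - 1) * lo + (1 - r) * w x)); last first.
      by move=> x /w_itv/andP[w0 w1]; rewrite ler0_norm; nra.
    rewrite (fin_mean_affine meanE) gtr0_norm; lra.
- exists id; split => //.
  rewrite (@eq_fin_mean _ _ _ _ meanE _ (fun=> 0)) ?(fin_mean_cst meanE)//.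
  by move=> x _; rewrite subrr normr0.
Qed.

(** Once the mean is right, the contraction of ratio [eta / a] towards it brings
    a deviation [a > eta] down to [eta]. *)
Lemma mad_shrink w (eta : R) : 0 <= eta ->
  (forall x, S x -> lo <= w x <= hi) -> E w = mu ->
  exists h, [/\ forall z, lo <= z <= hi -> lo <= h z <= hi,
    E (fun x => h (w x)) = mu,
    E (fun x => `|h (w x) - mu|) <= eta &
    E (fun x => `|h (w x) - w x|) <=
      Num.max 0 (E (fun x => `|w x - mu|) - eta)].
Proof.
move=> eta0 w_itv Ew; have /andP[lomu muhi] := mu_itv.
set a := E (fun x => `|w x - mu|).
have [aeta|etaa] := leP a eta.
  exists id; split => //.
  rewrite (@eq_fin_mean _ _ _ _ meanE _ (fun=> 0)); last first.
    by move=> x _; rewrite subrr normr0.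
  by rewrite (fin_mean_cst meanE) le_max lexx.
have a0 : 0 < a by exact: le_lt_trans etaa.
pose r := eta / a.
have r0 : 0 <= r by apply: divr_ge0; lra.
have r1 : r <= 1 by rewrite ler_pdivrMr// mul1r ltW.
have ra : r * a = eta by rewrite divfK// gt_eqF.
exists (fun z => (1 - r) * mu + r * z); split.
- by move=> z /andP[z0 z1]; apply/andP; split; nra.
- rewrite /= (fin_mean_affine meanE) Ew; ring.
- rewrite (@eq_fin_mean _ _ _ _ meanE _ (fun x => r * `|w x - mu|)); last first.
    by move=> x _; rewrite -[r in RHS]ger0_norm// -normrM; congr `|_|; ring.
  by rewrite (fin_meanZ meanE) ra.
- rewrite (@eq_fin_mean _ _ _ _ meanE _ (fun x => (1 - r) * `|w x - mu|)).
    by rewrite (fin_meanZ meanE) -/a le_max; apply/orP; right; lra.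
  move=> x _; rewrite -[1 - r in RHS]ger0_norm ?subr_ge0// -normrM distrC.
  by congr `|_|; ring.
Qed.

(** Both repairs in sequence.  The factor 2 accounts for the increase of the
    deviation by the first repair. *)
Lemma moment_repair w (eta : R) : 0 <= eta ->
  (forall x, S x -> lo <= w x <= hi) ->
  exists h, [/\ forall z, lo <= z <= hi -> lo <= h z <= hi,
    E (fun x => h (w x)) = mu,
    E (fun x => `|h (w x) - mu|) <= eta &
    E (fun x => `|h (w x) - w x|) <=
      2 * `|E w - mu| + Num.max 0 (E (fun x => `|w x - mu|) - eta)].
Proof.
move=> eta0 w_itv.
have [h1 [h1_itv h1E h1d]] := mean_recenter w_itv.
have h1w_itv x : S x -> lo <= h1 (w x) <= hi by move=> /w_itv/h1_itv.
have [h2 [h2_itv h2E h2eta h2d]] := mad_shrink eta0 h1w_itv h1E.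
exists (h2 \o h1); split => //; first by move=> z /h1_itv/h2_itv.
have dev : E (fun x => `|h1 (w x) - mu|) <=
    `|E w - mu| + E (fun x => `|w x - mu|).
  apply: le_trans (lerD h1d (lexx _)).
  rewrite -(fin_meanD meanE); apply: (le_fin_mean meanE) => x _.
  by rewrite -(subrKA (w x)) ler_normD.
have tri : E (fun x => `|(h2 \o h1) (w x) - w x|) <=
    E (fun x => `|h2 (h1 (w x)) - h1 (w x)|) + E (fun x => `|h1 (w x) - w x|).
  rewrite -(fin_meanD meanE); apply: (le_fin_mean meanE) => x _.
  by rewrite -(subrKA (h1 (w x))) ler_normD.
have mx : Num.max 0 (E (fun x => `|h1 (w x) - mu|) - eta) <=
    `|E w - mu| + Num.max 0 (E (fun x => `|w x - mu|) - eta).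
  rewrite ge_max addr_ge0 ?le_max ?lexx//=.
  have : E (fun x => `|w x - mu|) - eta <= Num.max 0 (E (fun x => `|w x - mu|) - eta).
    by rewrite le_max lexx orbT.
  lra.
lra.
Qed.

End repair.

(** * Topology and measurability of the demand space *)

Section matrix_topology.
Variables (R : realType) (m n : nat).

Lemma continuous_to_matrix (X : topologicalType) (f : X -> 'M[R]_(m, n)) :
  (forall i j, continuous (fun x => f x i j)) -> continuous f.
Proof.
move=> fc x; apply/cvg_mx_entourageP => A entA.
have : \forall y \near x, forall ij : 'I_m * 'I_n,
    (f x ij.1 ij.2, f y ij.1 ij.2) \in A.
  apply: filter_forall => -[i j] /=.
  have /cvg_app_entourageP/(_ _ entA) := fc i j x.
  by apply: filterS => y; rewrite inE.
by apply: filterS => y Ay i j; exact: (Ay (i, j)).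
Qed.

Lemma compact_entrywise (A : 'I_m -> 'I_n -> set R) :
  (forall i j, compact (A i j)) ->
  compact [set W : 'M[R]_(m, n) | forall i j, A i j (W i j)].
Proof.
move=> Ac.
(* The entries are laid out as one row vector, whose box is compact. *)
pose B (k : 'I_(m * n)) :=
  [set r | forall i j, mxvec_index i j = k -> A i j r].
have Bc k : compact (B k).
  case/mxvec_indexP: k => i j.
  suff -> : B (mxvec_index i j) = A i j by [].
  apply/seteqP; split=> [r /(_ i j erefl)//|r Ar i' j' eqk].
  have [-> ->//] : (i', j') = (i, j).
  have [g gK _] := curry_mxvec_bij m n.
  by rewrite -[LHS]gK// -[RHS]gK//= eqk.
have -> : [set W : 'M[R]_(m, n) | forall i j, A i j (W i j)] =
    vec_mx @` [set v : 'rV[R]_(m * n) | forall k, B k (v ord0 k)].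
  apply/seteqP; split=> [W AW|_ [v Bv <-] i j /=].
    exists (mxvec W); last by rewrite mxvecK.
    by move=> k i j <-; rewrite mxvecE.
  by rewrite mxE; exact: Bv.
apply: continuous_compact; last exact: rV_compact.
apply: continuous_subspaceT; apply: continuous_to_matrix => i j.
rewrite (_ : (fun _ => _) = (fun v : 'rV[R]_(m * n) => v ord0 (mxvec_index i j))).
  exact: coord_continuous.
by apply/funext => v; rewrite mxE.
Qed.

Lemma closed_entrywise (A : 'I_m -> 'I_n -> set R) :
  (forall i j, closed (A i j)) ->
  closed [set W : 'M[R]_(m, n) | forall i j, A i j (W i j)].
Proof.
move=> Ac.
have -> : [set W : 'M[R]_(m, n) | forall i j, A i j (W i j)] =
    \bigcap_(ij in [set: 'I_m * 'I_n])
      (fun W : 'M[R]_(m, n) => W ij.1 ij.2) @^-1` A ij.1 ij.2.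
  by apply/seteqP; split=> W /= AW => [[i j] _|i j]; [exact: AW|exact: (AW (i, j))].
apply: closed_bigI => -[i j] _; apply: closed_comp => //= W _.
exact: coord_continuous.
Qed.

End matrix_topology.

Section demand_measurability.
Variables (R : realType) (nI nT : nat).

Lemma open_demand_measurable (A : set 'M[R]_(nI, nT)) :
  open A -> measurable (A : set (demand_space R nI nT)).
Proof. exact: sub_sigma_algebra. Qed.

Lemma closed_demand_measurable (A : set 'M[R]_(nI, nT)) :
  closed A -> measurable (A : set (demand_space R nI nT)).
Proof.
move=> /closed_openC /open_demand_measurable.
by move=> /(@measurableC _ (demand_space R nI nT)); rewrite setCK.
Qed.

Lemma continuous_demand_measurable (f : 'M[R]_(nI, nT) -> R) :
  continuous f -> measurable_fun [set: demand_space R nI nT] f.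
Proof.
move=> /continuousP cf; apply: (measurability _ (RGenOpens.measurableE R)).
move=> _ [_ [a [b ->] <-]]; rewrite setTI.
by apply: open_demand_measurable; apply: cf; exact: interval_open.
Qed.

End demand_measurability.

Section demand_support.
Variables (R : realType) (nI nT : nat) (lo hi : 'M[R]_(nI, nT)).
Hypothesis lo_ge0 : forall i t, 0 <= lo i t.

Lemma demand_supportP W :
  demand_support lo hi W <-> forall i t, lo i t <= W i t <= hi i t.
Proof.
split=> [SW i t|W_itv i t]; first by have [] := SW i t.
split; last exact: W_itv.
by have /andP[+ _] := W_itv i t; exact: le_trans.
Qed.

Lemma demand_supportE : demand_support lo hi =
  [set W | forall i t, `[lo i t, hi i t]%classic (W i t)].
Proof.
apply/seteqP; split=> W.
  by move=> /demand_supportP W_itv i t; rewrite /= in_itv/=.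
by move=> W_itv; apply/demand_supportP => i t; have := W_itv i t; rewrite /= in_itv.
Qed.

Lemma compact_demand_support : compact (demand_support lo hi).
Proof.
rewrite demand_supportE.
apply: (@compact_entrywise _ _ _ (fun i t => `[lo i t, hi i t]%classic)) => i t.
exact: segment_compact.
Qed.

Lemma measurable_demand_support :
  measurable (demand_support lo hi : set (demand_space R nI nT)).
Proof.
apply: closed_demand_measurable; rewrite demand_supportE.
apply: (@closed_entrywise _ _ _ (fun i t => `[lo i t, hi i t]%classic)) => i t.
exact: interval_closed.
Qed.

End demand_support.
Arguments demand_supportP {R nI nT lo} hi lo_ge0 W.

Lemma continuous_sum2 (R : realType) (X : topologicalType) (m n : nat)
    (F : 'I_m -> 'I_n -> X -> R) :
  (forall i t, continuous (F i t)) ->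
  continuous (fun x => \sum_(t < n) \sum_(i < m) F i t x).
Proof.
move=> Fc; apply: continuous_big => [|t _]; first exact: add_continuous.
by apply: continuous_big => [|i _]; [exact: add_continuous|exact: Fc].
Qed.

Lemma lipschitz_continuous (R : realType) (m n : nat) (K : R)
    (f : 'M[R]_(m, n) -> R) : 0 <= K ->
  (forall W W', f W <= f W' + K * \sum_(t < n) \sum_(i < m) `|W i t - W' i t|) ->
  continuous f.
Proof.
move=> K0 fK W.
pose h (W' : 'M[R]_(m, n)) : R := \sum_(t < n) \sum_(i < m) `|W i t - W' i t|.
have hc : h W' @[W' --> W] --> h W.
  apply: continuous_sum2 => i t V; have cW := @coord_continuous R m n i t V.
  exact: (cvg_norm (cvgB (cvg_cst (W i t)) cW)).
pose g W' := K * h W'.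
have gc : g W' @[W' --> W] --> (0 : R).
  have <- : K * h W = 0.
    rewrite /h big1 ?mulr0// => t _; rewrite big1// => i _.
    by rewrite subrr normr0.
  exact: (cvgM (cvg_cst K) hc).
apply: (squeeze_cvgr (f := fun W' => f W - g W') (h := fun W' => f W + g W')).
- exact: (@nbhs_filter _ W).
- near=> W'; apply/andP; split; first by rewrite lerBlDr; exact: fK.
  apply: le_trans (fK W' W) _; rewrite lerD2l.
  by apply: ler_wpM2l => //; do 2 (apply: ler_sum => ? _); rewrite distrC.
- by rewrite -[X in _ --> X]subr0; exact: (cvgB (cvg_cst (f W)) gc).
- by rewrite -[X in _ --> X]addr0; exact: (cvgD (cvg_cst (f W)) gc).
Unshelve. all: by end_near. Qed.

(** * Strong duality *)

Lemma matrix_scalarE (R : realType) (nI nT : nat)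
    (l : {scalar ('M[R]_(nI, nT) * 'M[R]_(nI, nT))%type}) v :
  l v = \sum_(t < nT) \sum_(i < nI)
    (v.1 i t * l (delta_mx i t, 0) + v.2 i t * l (0, delta_mx i t)).
Proof.
have {1}-> : v = \sum_(t < nT) \sum_(i < nI)
    (v.1 i t *: (delta_mx i t, 0) + v.2 i t *: (0, delta_mx i t)).
  rewrite exchange_big/=.
  apply: injective_projections.
  - rewrite [LHS]matrix_sum_delta (raddf_sum fst)/=; apply: eq_bigr => i _.
    rewrite (raddf_sum fst)/=; apply: eq_bigr => t _.
    by rewrite scaler0 addr0.
  - rewrite [LHS]matrix_sum_delta (raddf_sum snd)/=; apply: eq_bigr => i _.
    rewrite (raddf_sum snd)/=; apply: eq_bigr => t _.
    by rewrite scaler0 add0r.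
rewrite linear_sum; apply: eq_bigr => t _.
rewrite linear_sum; apply: eq_bigr => i _.
by rewrite linearD !linearZ.
Qed.

Section duality.
Variables (R : realType) (nI nT : nat) (lo hi mu eta : 'M[R]_(nI, nT)).
Variables (gamma : R) (Q : 'M[R]_(nI, nT) -> R).
Local Notation S := (demand_support lo hi).
Hypothesis lo_ge0 : forall i t, 0 <= lo i t.
Hypothesis S_mu : S mu.
Hypothesis eta_ge0 : forall i t, 0 <= eta i t.
Hypothesis gamma_ge0 : 0 <= gamma.
Hypothesis Q_lip : forall W W', S W -> S W' ->
  Q W <= Q W' + gamma * \sum_(t < nT) \sum_(i < nI) `|W i t - W' i t|.
Hypothesis Q_meas : measurable_fun [set: demand_space R nI nT] Q.

(** A finitely supported distribution with admissible moments belongs to the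
    ambiguity set. *)
Lemma fin_mean_le_worst_case (E : ('M[R]_(nI, nT) -> R) -> R) :
  fin_mean S E ->
  (forall i t, E (fun W => W i t) = mu i t) ->
  (forall i t, E (fun W => `|W i t - mu i t|) <= eta i t) ->
  ((E Q)%:E <= worst_case_expectation S mu eta Q)%E.
Proof.
move=> hE Emu Eeta.
have mS := measurable_demand_support hi lo_ge0.
have [P [PS PE]] := @fin_mean_probability _ (demand_space R nI nT) R _ _ mS hE.
apply: ereal_sup_ubound; exists P; last exact: PE.
split=> // i t.
- by rewrite PE ?Emu//; apply: continuous_demand_measurable; exact: coord_continuous.
- rewrite PE ?lee_fin//; apply: continuous_demand_measurable => W.
  have cW := @coord_continuous R nI nT i t W.
  exact: (cvg_norm (cvgB cW (cvg_cst (mu i t)))).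
Qed.

(** The charge for violating the moment constraints, the required mean being
    [mu + v.1] and the allowed deviation [eta + v.2]. *)
Definition moment_penalty (E : ('M[R]_(nI, nT) -> R) -> R)
    (v : 'M[R]_(nI, nT) * 'M[R]_(nI, nT)) : R :=
  gamma * \sum_(t < nT) \sum_(i < nI)
    (2 * `|E (fun W => W i t) - mu i t - v.1 i t|
     + Num.max 0 (E (fun W => `|W i t - mu i t|) - eta i t - v.2 i t)).

(** Exactness of the penalty: repairing the moments of [E] costs at most
    [moment_penalty E 0]. *)
Lemma penalized_le_worst_case (E : ('M[R]_(nI, nT) -> R) -> R) :
  fin_mean S E ->
  ((E Q - moment_penalty E 0)%:E <= worst_case_expectation S mu eta Q)%E.
Proof.
move=> hE.
have /choice[h hP] : forall it : 'I_nI * 'I_nT, exists h : R -> R,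
    [/\ forall z, lo it.1 it.2 <= z <= hi it.1 it.2 ->
          lo it.1 it.2 <= h z <= hi it.1 it.2,
      E (fun W => h (W it.1 it.2)) = mu it.1 it.2,
      E (fun W => `|h (W it.1 it.2) - mu it.1 it.2|) <= eta it.1 it.2 &
      E (fun W => `|h (W it.1 it.2) - W it.1 it.2|) <=
        2 * `|E (fun W => W it.1 it.2) - mu it.1 it.2|
        + Num.max 0 (E (fun W => `|W it.1 it.2 - mu it.1 it.2|) - eta it.1 it.2)].
  move=> [i t] /=; apply: (moment_repair hE) => //.
  - by have /(demand_supportP hi lo_ge0) := S_mu; apply.
  - by move=> W /(demand_supportP hi lo_ge0); apply.
pose T W : 'M[R]_(nI, nT) := \matrix_(i, t) h (i, t) (W i t).
have T_S W : S W -> S (T W).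
  move=> /(demand_supportP hi lo_ge0) W_itv.
  apply/(demand_supportP hi lo_ge0) => i t; rewrite mxE.
  by have [+ _ _ _] := hP (i, t); apply; exact: W_itv.
have hET := fin_mean_comp hE T_S.
apply: le_trans (fin_mean_le_worst_case hET _ _); last 2 first.
- move=> i t; have [_ <- _ _] := hP (i, t).
  by congr E; apply/funext => W /=; rewrite mxE.
- move=> i t; have [_ _ + _] := hP (i, t); apply: le_trans.
  by rewrite le_eqVlt; apply/orP; left; apply/eqP; congr E; apply/funext => W /=;
    rewrite mxE.
rewrite lee_fin lerBlDr.
have : E Q <= E (fun W => (Q \o T) W +
    gamma * \sum_(t < nT) \sum_(i < nI) `|T W i t - W i t|).
  apply: (le_fin_mean hE) => W SW; apply: le_trans (Q_lip SW (T_S _ SW)) _.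
  rewrite lerD2l; apply: ler_wpM2l => //.
  by do 2 (apply: ler_sum => ? _); rewrite distrC.
move=> /le_trans; apply.
rewrite (fin_meanD hE) (fin_meanZ hE) lerD2l; apply: ler_wpM2l => //.
rewrite (fin_mean_sum hE); apply: ler_sum => t _.
rewrite (fin_mean_sum hE); apply: ler_sum => i _.
have [_ _ _ /=] := hP (i, t).
rewrite !mxE !subr0; apply: le_trans.
rewrite le_eqVlt; apply/orP; left; apply/eqP; congr E; apply/funext => W /=.
by rewrite mxE.
Qed.

(** The optimal value of the penalized moment problem, as a minimization, in
    terms of the perturbation [v]. *)
Definition perturbed_value (v : 'M[R]_(nI, nT) * 'M[R]_(nI, nT)) : R :=
  inf [set r | exists2 E, fin_mean S E & r = moment_penalty E v - E Q].

Lemma moment_penalty_ge0 E v : 0 <= moment_penalty E v.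
Proof.
apply: mulr_ge0 => //; do 2 (apply: sumr_ge0 => ? _).
by rewrite addr_ge0 ?mulr_ge0// le_max lexx.
Qed.

Lemma perturbed_value_has_inf v :
  has_inf [set r | exists2 E, fin_mean S E & r = moment_penalty E v - E Q].
Proof.
split.
  exists (moment_penalty (fun f => f mu) v - Q mu), (fun f => f mu) => //.
  exact: fin_mean_dirac.
exists (- (Q mu + gamma * \sum_(t < nT) \sum_(i < nI) (hi i t - lo i t))).
move=> _ [E hE ->].
rewrite -[leLHS]add0r; apply: lerD; first exact: moment_penalty_ge0.
rewrite lerN2 -(fin_mean_cst hE (_ + _)); apply: (le_fin_mean hE) => W SW.
apply: le_trans (Q_lip SW S_mu) _; rewrite lerD2l; apply: ler_wpM2l => //.
apply: ler_sum => t _; apply: ler_sum => i _.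
have /(demand_supportP hi lo_ge0)/(_ i t)/andP[l1 l2] := SW.
have /(demand_supportP hi lo_ge0)/(_ i t)/andP[m1 m2] := S_mu.
by rewrite ler_norml; apply/andP; split; lra.
Qed.

Lemma convex_perturbed_value : convex_fun perturbed_value.
Proof.
apply: convex_inf => [|s x y _ _ s01 [E hE ->] [F hF ->]].
  exact: perturbed_value_has_inf.
pose G f := s * E f + (1 - s) * F f.
exists (moment_penalty G (s *: x + (1 - s) *: y) - G Q).
  by exists G => //; exact: fin_mean_mix.
have /andP[s0 s1] := s01; have s1' : 0 <= 1 - s by rewrite subr_ge0.
suff : moment_penalty G (s *: x + (1 - s) *: y) <=
    s * moment_penalty E x + (1 - s) * moment_penalty F y.
  rewrite /G; lra.
rewrite /moment_penalty mulrCA (mulrCA (1 - s)) -mulrDr; apply: ler_wpM2l => //.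
rewrite !mulr_sumr -big_split/=; apply: ler_sum => t _.
rewrite !mulr_sumr -big_split/=; apply: ler_sum => i _.
rewrite /G !mxE.
set a := E _; set b := F _; set a' := E _; set b' := F _.
have -> : s * a + (1 - s) * b - mu i t - (s * x.1 i t + (1 - s) * y.1 i t) =
    s * (a - mu i t - x.1 i t) + (1 - s) * (b - mu i t - y.1 i t) by ring.
have -> : s * a' + (1 - s) * b' - eta i t - (s * x.2 i t + (1 - s) * y.2 i t) =
    s * (a' - eta i t - x.2 i t) + (1 - s) * (b' - eta i t - y.2 i t) by ring.
set p := a - _ - _; set q := b - _ - _; set p' := a' - _ - _; set q' := b' - _ - _.
have h1 : `|s * p + (1 - s) * q| <= s * `|p| + (1 - s) * `|q|.
  by apply: le_trans (ler_normD _ _) _; rewrite !normrM (ger0_norm s0) (ger0_norm s1').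
have mx (r : R) : 0 <= Num.max 0 r /\ r <= Num.max 0 r.
  by rewrite !le_max !lexx orbT.
have h2 : Num.max 0 (s * p' + (1 - s) * q') <=
    s * Num.max 0 p' + (1 - s) * Num.max 0 q'.
  have [? ?] := mx p'; have [? ?] := mx q'.
  rewrite ge_max; apply/andP; split.
    by rewrite addr_ge0// mulr_ge0.
  by apply: lerD; apply: ler_wpM2l.
lra.
Qed.

Lemma strong_duality : exists rho psi : 'M[R]_(nI, nT),
  (forall i t, 0 <= psi i t) /\
  forall W, S W ->
    ((\sum_(t < nT) \sum_(i < nI) (mu i t * rho i t + eta i t * psi i t)
      + inner_objective mu Q rho psi W)%:E
     <= worst_case_expectation S mu eta Q)%E.
Proof.
have [l lP] := convex_subgradient convex_perturbed_value.
have value0 : ((- perturbed_value 0)%:E <= worst_case_expectation S mu eta Q)%E.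
  have pen_le E (hE : fin_mean S E) := penalized_le_worst_case hE.
  case: (worst_case_expectation S mu eta Q) pen_le => [r| |] pen_le.
  - rewrite lee_fin lerNl; apply: lb_le_inf.
      exact: (perturbed_value_has_inf 0).1.
    move=> _ [E hE ->]; have := pen_le E hE; rewrite lee_fin; lra.
  - by rewrite leey.
  - by have := pen_le _ (fin_mean_dirac R S_mu).
exists (\matrix_(i, t) - l (delta_mx i t, 0)), (\matrix_(i, t) - l (0, delta_mx i t)).
split=> [i t|W SW].
  rewrite mxE oppr_ge0.
  (* Allowing a larger deviation does not increase the value. *)
  suff : perturbed_value (0, delta_mx i t) <= perturbed_value 0.
    by have := lP (0, delta_mx i t); lra.
  apply: lb_le_inf; first exact: (perturbed_value_has_inf 0).1.
  move=> _ [E hE ->].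
  apply: (le_trans (y := moment_penalty E (0, delta_mx i t) - E Q)).
    by apply: (ge_inf (perturbed_value_has_inf _).2); exists E.
  rewrite lerD2r; apply: ler_wpM2l => //.
  apply: ler_sum => t' _; apply: ler_sum => i' _ /=; rewrite lerD2l.
  rewrite ge_max le_max lexx/= le_max; apply/orP; right.
  by rewrite lerD2l lerN2 !mxE ler0n.
(* The perturbation whose constraints the Dirac mass at [W] meets exactly. *)
pose v : 'M[R]_(nI, nT) * 'M[R]_(nI, nT) :=
  (W - mu, \matrix_(i, t) (`|W i t - mu i t| - eta i t)).
apply: le_trans value0; rewrite lee_fin.
have vQ : perturbed_value v <= - Q W.
  apply: (ge_inf (perturbed_value_has_inf _).2).
  exists (fun f => f W); first exact: fin_mean_dirac.
  rewrite /moment_penalty big1 ?mulr0 ?sub0r// => t _.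
  rewrite big1// => i _; rewrite /v/= !mxE !subrr normr0 mulr0 add0r.
  by rewrite maxxx.
have := lP v; rewrite (matrix_scalarE l v) /inner_objective.
set L := \sum_(t < nT) _; set A := \sum_(t < nT) _; set B := \sum_(t < nT) _.
suff : A + B = L by lra.
rewrite /A /B -big_split/=; apply: eq_bigr => t _.
rewrite -big_split/=; apply: eq_bigr => i _.
rewrite !mxE; ring.
Qed.

End duality.

(** * Weak duality *)

Section support_expectation.
Context d (T : measurableType d) (R : realType) (P : probability T R).
Variable S : set T.
Hypotheses (mS : measurable S) (PS : P S = 1%E).

Lemma expectation_support (f : T -> R) : measurable_fun [set: T] f ->
  'E_P[f]%E = (\int[P]_(x in S) (f x)%:E)%E.
Proof.
move=> mf; rewrite unlock [RHS]integral_mkcond.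
apply: ae_eq_integral => //; first exact/measurable_EFinP.
  apply/(measurable_restrictT _ mS).1/measurable_funTS.
  exact/measurable_EFinP.
exists (~` S); split; first exact: measurableC.
  by have := probability_setC P mS; rewrite PS subee.
apply: subsetC => x Sx _ /=.
by rewrite patchE mem_set.
Qed.

Lemma bounded_support_integrable (f : T -> R) (B : R) :
  measurable_fun [set: T] f -> (forall x, S x -> `|f x| <= B) ->
  P.-integrable S (fun x => (f x)%:E).
Proof.
move=> mf fB; apply: (@measurable_bounded_integrable _ _ _ P f) => //.
- exact: le_lt_trans (probability_le1 P mS) (ltry _).
- exact: measurable_funTS.
- exists B; split; rewrite ?num_real// => y By x Sx.
  exact: le_trans (fB x Sx) (ltW By).
Qed.

End support_expectation.

Section weak_duality.
Variables (R : realType) (nI nT : nat) (lo hi mu eta : 'M[R]_(nI, nT)).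
Variable (Q : 'M[R]_(nI, nT) -> R).
Local Notation S := (demand_support lo hi).
Hypothesis Q_ge0 : forall W, S W -> 0 <= Q W.
Hypothesis Q_meas : measurable_fun [set: demand_space R nI nT] Q.

(** Integration over the support of the bound
    [Q W <= c + sum (W rho + |W - mu| psi)]. *)
Lemma weak_duality (rho psi : 'M[R]_(nI, nT)) (c : R)
    (lo_ge0 : forall i t, 0 <= lo i t) (S_mu : S mu) :
  (forall i t, 0 <= psi i t) ->
  (forall W, S W -> inner_objective mu Q rho psi W <= c) ->
  (worst_case_expectation S mu eta Q <=
   (\sum_(t < nT) \sum_(i < nI) (mu i t * rho i t + eta i t * psi i t) + c)%:E)%E.
Proof.
move=> psi0 Qc; apply: ge_ereal_sup => _ [P [PS Pmu Peta] <-].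
have mS : measurable (S : set (demand_space R nI nT)).
  exact: measurable_demand_support.
have mW i t : measurable_fun [set: demand_space R nI nT]
    (fun W : 'M[R]_(nI, nT) => W i t).
  by apply: continuous_demand_measurable; exact: coord_continuous.
have mD i t : measurable_fun [set: demand_space R nI nT]
    (fun W : 'M[R]_(nI, nT) => `|W i t - mu i t|).
  by apply: measurableT_comp => //; apply: measurable_funB.
have iW i t : P.-integrable S (fun W : 'M[R]_(nI, nT) => (W i t)%:E).
  apply: (bounded_support_integrable P mS (B := hi i t) (mW i t)) => W.
  by move=> /(_ i t)[W0 /andP[_]]; rewrite ger0_norm.
have iD i t : P.-integrable S (fun W : 'M[R]_(nI, nT) => `|W i t - mu i t|%:E).
  apply: (bounded_support_integrable P mS (B := hi i t - lo i t) (mD i t)) => W.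
  move=> /(_ i t)[_ /andP[W1 W2]]; have [_ /andP[m1 m2]] := S_mu i t.
  by rewrite normr_id ler_norml; apply/andP; split; lra.
pose g (W : 'M[R]_(nI, nT)) : R :=
  c + \sum_(t < nT) \sum_(i < nI) (W i t * rho i t + `|W i t - mu i t| * psi i t).
have mg : measurable_fun [set: demand_space R nI nT] g.
  apply: measurable_funD; first exact: measurable_cst.
  apply: measurable_sum => t; apply: measurable_sum => i.
  by apply: measurable_funD; apply: measurable_funM.
have Qg W : S W -> Q W <= g W.
  move=> SW; have := Qc W SW; rewrite /inner_objective /g.
  under eq_bigr do rewrite sumrN.
  rewrite sumrN; lra.
rewrite (expectation_support mS PS Q_meas).
apply: (@le_trans _ _ (\int[P]_(W in S) (g W)%:E)%E).
  apply: ge0_le_integral => //.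
  - by apply/measurable_EFinP; exact: measurable_funTS.
  - by apply/measurable_EFinP; exact: measurable_funTS.
have iWr i t : P.-integrable S
    (fun W : 'M[R]_(nI, nT) => (W i t)%:E * (rho i t)%:E)%E.
  exact: integrableZr.
have iDr i t : P.-integrable S
    (fun W : 'M[R]_(nI, nT) => `|W i t - mu i t|%:E * (psi i t)%:E)%E.
  exact: integrableZr.
have iWD i t : P.-integrable S (fun W : 'M[R]_(nI, nT) =>
    (W i t)%:E * (rho i t)%:E + `|W i t - mu i t|%:E * (psi i t)%:E)%E.
  exact: integrableD.
have iS t : P.-integrable S (fun W : 'M[R]_(nI, nT) => \sum_(i < nI)
    ((W i t)%:E * (rho i t)%:E + `|W i t - mu i t|%:E * (psi i t)%:E))%E.
  exact: integrable_sum.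
have -> : (\int[P]_(W in S) (g W)%:E = \int[P]_(W in S) (cst c%:E W +
    \sum_(t < nT) \sum_(i < nI)
    ((W i t)%:E * (rho i t)%:E + `|W i t - mu i t|%:E * (psi i t)%:E)))%E.
  apply: eq_integral => W _; rewrite /g EFinD; congr (_ + _)%E.
  rewrite -sumEFin; apply: eq_bigr => t _; rewrite -sumEFin.
  by apply: eq_bigr => i _; rewrite EFinD !EFinM.
rewrite integralD//; last 2 first.
- apply: (bounded_support_integrable P mS (B := `|c|) (f := fun=> c)) => //.
- exact: integrable_sum.
rewrite integral_cst// [X in (_ * X + _)%E]PS mule1 EFinD addeC; apply: leeD => //.
rewrite integral_sum// -sumEFin; apply: lee_sum => t _.
rewrite integral_sum// -sumEFin; apply: lee_sum => i _.
rewrite integralD// !integralZr// EFinD !EFinM; apply: leeD.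
  by rewrite -(expectation_support mS PS (mW i t)) Pmu.
apply: lee_wpmul2r; first by rewrite lee_fin.
by rewrite -(expectation_support mS PS (mD i t)) Peta.
Qed.

End weak_duality.


(** * The recourse function *)

Section recourse_theory.
Variables (R : realType) (nI nJ nM nT : nat) (beta gamma C : R).
Variables (d : 'I_nI -> 'I_nJ -> R) (x : 'I_nJ -> 'I_nM -> 'I_nT -> bool).
Hypotheses (d_ge0 : forall i j, 0 <= d i j) (beta_ge0 : 0 <= beta).
Hypotheses (C_ge0 : 0 <= C) (gamma_ge0 : 0 <= gamma).
Local Notation Q := (recourse beta gamma C d x).
Implicit Types W : 'M[R]_(nI, nT).

Lemma recourse_values_ge0 W : lbound (recourse_values beta gamma C d x W) 0.
Proof.
move=> _ [z [u [[_ _ u0 z0] ->]]]; apply: addr_ge0.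
  by do 4 (apply: sumr_ge0 => ? _); rewrite !mulr_ge0.
by apply: mulr_ge0 => //; do 2 (apply: sumr_ge0 => ? _).
Qed.

Lemma recourse_ge0 W : (forall i t, 0 <= W i t) -> 0 <= Q W.
Proof.
move=> W0; apply: lb_le_inf; last exact: recourse_values_ge0.
by have [] := recourse_has_inf x d_ge0 beta_ge0 C_ge0 gamma_ge0 W0.
Qed.

(** From a feasible plan for [W'], a plan for [W] is obtained by scaling down
    the service of the customers whose demand has decreased, and by leaving
    unmet the increase of the others. *)
Lemma recourse_lipschitz_pos W W' :
  (forall i t, 0 <= W i t) -> (forall i t, 0 <= W' i t) ->
  Q W <= Q W' + gamma * \sum_(t < nT) \sum_(i < nI) Num.max 0 (W i t - W' i t).
Proof.
move=> W0 W'0; rewrite -lerBlDr; apply: lb_le_inf.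
  by have [] := recourse_has_inf x d_ge0 beta_ge0 C_ge0 gamma_ge0 W'0.
move=> _ [z [u [[zu zC u0 z0] ->]]]; rewrite lerBlDr.
(* The fraction of the service in the plan for [W'] that is kept. *)
pose r i t := if W i t < W' i t then W i t / W' i t else 1.
have r01 i t : 0 <= r i t <= 1.
  rewrite /r; case: ltP => [lt_W|_]; last by rewrite ler01 lexx.
  have W'_gt0 : 0 < W' i t by exact: le_lt_trans lt_W.
  by rewrite divr_ge0//= ler_pdivrMr// mul1r ltW.
pose z' i j m t := r i t * z i j m t.
pose u' := \matrix_(i, t) (r i t * u i t + Num.max 0 (W i t - W' i t)).
apply: (le_trans (y := recourse_cost beta gamma d z' u')).
  apply: ge_inf; first by exists 0; exact: recourse_values_ge0.
  exists z', u'; split => //; split.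
  - move=> i t; rewrite mxE addrA -[X in X + _ + _](_ : r i t *
        (\sum_(j < nJ) \sum_(m < nM) z i j m t) = _); last first.
      by rewrite mulr_sumr; apply: eq_bigr => j _; rewrite mulr_sumr.
    rewrite -mulrDr zu /r; case: ltP => [lt_W|le_W].
      have W'_gt0 : 0 < W' i t by exact: le_lt_trans lt_W.
      by rewrite divfK ?gt_eqF// max_l ?addr0// subr_le0 ltW.
    by rewrite mul1r max_r ?subr_ge0// addrC subrK.
  - move=> j m t; apply: le_trans (zC j m t); apply: ler_sum => i _.
    by have /andP[_ r1] := r01 i t; apply: ler_piMl.
  - move=> i t; rewrite mxE; have /andP[r0 _] := r01 i t.
    by rewrite addr_ge0 ?mulr_ge0// le_max lexx.
  - by move=> i j m t; have /andP[r0 _] := r01 i t; exact: mulr_ge0.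
rewrite /recourse_cost -addrA; apply: lerD.
  apply: ler_sum => j _; apply: ler_sum => i _.
  apply: ler_sum => m _; apply: ler_sum => t _.
  rewrite ler_wpM2l ?mulr_ge0//.
  by have /andP[_ r1] := r01 i t; exact: ler_piMl.
rewrite -mulrDr; apply: ler_wpM2l => //.
rewrite -big_split/=; apply: ler_sum => t _.
rewrite -big_split/=; apply: ler_sum => i _.
by rewrite mxE lerD2r; have /andP[_ r1] := r01 i t; exact: ler_piMl.
Qed.

Lemma recourse_lipschitz W W' :
  (forall i t, 0 <= W i t) -> (forall i t, 0 <= W' i t) ->
  Q W <= Q W' + gamma * \sum_(t < nT) \sum_(i < nI) `|W i t - W' i t|.
Proof.
move=> W0 W'0; apply: le_trans (recourse_lipschitz_pos W0 W'0) _.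
rewrite lerD2l; apply: ler_wpM2l => //; do 2 (apply: ler_sum => ? _).
by rewrite ge_max normr_ge0 ler_norm.
Qed.

(** The entrywise positive part, a projection onto the nonnegative orthant. *)
Definition posmx W : 'M[R]_(nI, nT) := \matrix_(i, t) Num.max 0 (W i t).

Lemma posmx_id W : (forall i t, 0 <= W i t) -> posmx W = W.
Proof. by move=> W0; apply/matrixP => i t; rewrite mxE max_r. Qed.

Lemma continuous_recourse_posmx : continuous (fun W => Q (posmx W)).
Proof.
have pos0 W i t : 0 <= posmx W i t by rewrite mxE le_max lexx.
apply: (lipschitz_continuous gamma_ge0) => W W'.
apply: le_trans (recourse_lipschitz (pos0 W) (pos0 W')) _.
rewrite lerD2l; apply: ler_wpM2l => //.
apply: ler_sum => t _; apply: ler_sum => i _; rewrite !mxE ler_norml.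
have := ler_norm (W i t - W' i t); have := ler_norm (W' i t - W i t).
rewrite (distrC (W' i t)).
by case: (lerP 0 (W i t)); case: (lerP 0 (W' i t)) => *; apply/andP; split; lra.
Qed.

(** Outside the nonnegative orthant the program is infeasible and the infimum
    over the empty set is [0]. *)
Lemma measurable_recourse :
  measurable_fun [set: demand_space R nI nT] (Q : demand_space R nI nT -> R).
Proof.
pose N := [set W : 'M[R]_(nI, nT) | forall i t, 0 <= W i t].
have mN : measurable (N : set (demand_space R nI nT)).
  apply: closed_demand_measurable.
  apply: (@closed_entrywise _ _ _ (fun _ _ => [set r | 0 <= r])) => i t.
  exact: closed_ge.
have -> : Q = ((fun W => Q (posmx W)) \_ N).
  apply/funext => W; rewrite patchE; case: ifPn => [|/negP] WN.
    by rewrite posmx_id//; exact: set_mem WN.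
  rewrite /recourse (_ : recourse_values _ _ _ _ _ _ = set0) ?inf0//.
  apply/seteqP; split=> // c [z [u [[zu _ u0 z0] _]]]; apply: WN.
  apply/mem_set => i t; rewrite -zu addr_ge0//.
  by do 2 (apply: sumr_ge0 => ? _).
apply: (measurable_restrictT _ mN).1; apply: measurable_funTS.
exact: (continuous_demand_measurable continuous_recourse_posmx).
Qed.

End recourse_theory.

(** The inner maximum is attained as soon as [Q] agrees on the support with a
    continuous function [F]. *)
Lemma inner_objective_max (R : realType) (nI nT : nat)
    (lo hi mu : 'M[R]_(nI, nT)) (Q F : 'M[R]_(nI, nT) -> R)
    (rho psi : 'M[R]_(nI, nT)) :
  (forall i t, 0 <= lo i t) -> demand_support lo hi mu -> continuous F ->
  (forall W, demand_support lo hi W -> Q W = F W) ->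
  exists2 W, demand_support lo hi W & forall W', demand_support lo hi W' ->
    inner_objective mu Q rho psi W' <= inner_objective mu Q rho psi W.
Proof.
move=> lo0 S_mu Fc QF.
have sum_c : continuous (fun W : 'M[R]_(nI, nT) => \sum_(t < nT) \sum_(i < nI)
    - (W i t * rho i t + `|W i t - mu i t| * psi i t)).
  apply: continuous_sum2 => i t W; have cW := @coord_continuous R nI nT i t W.
  exact: (cvgN (cvgD (cvgM cW (cvg_cst _))
                     (cvgM (cvg_norm (cvgB cW (cvg_cst _))) (cvg_cst _)))).
have Ic : continuous (inner_objective mu F rho psi).
  by move=> W; exact: (cvgD (Fc W) (sum_c W)).
have S_neq0 : demand_support lo hi !=set0 by exists mu.
have cS := compact_demand_support (hi := hi) lo0.
have [W /set_mem SW Wmax] := compact_EVT_max S_neq0 cS (continuous_subspaceT Ic).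
exists W => // W' SW'; rewrite /inner_objective !QF//.
by apply: Wmax; exact/mem_set.
Qed.

(** * The minimum of the dual *)

Theorem proposition1 (R : realType) (nI nJ nM nT : nat)
    (hI : (0 < nI)%N) (hJ : (0 < nJ)%N) (hM : (0 < nM)%N)
    (d : 'I_nI -> 'I_nJ -> R) (travel : 'I_nJ -> 'I_nJ -> nat)
    (beta C gamma : R)
    (hd : forall i j, 0 <= d i j)
    (hbeta : 0 <= beta) (hC : 0 <= C) (hgamma : 0 <= gamma)
    (Wlo Whi : 'M[R]_(nI, nT))
    (hbounds : forall i t, 0 <= Wlo i t <= Whi i t)
    (mu eta : 'M[R]_(nI, nT))
    (hmu : demand_support Wlo Whi mu) (heta : forall i t, 0 <= eta i t)
    (x : 'I_nJ -> 'I_nM -> 'I_nT -> bool) (y : 'I_nM -> bool)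
    (hxy : first_stage_feasible travel x y) :
  let S := demand_support Wlo Whi in
  let Q := recourse beta gamma C d x in
  (* the inner maximum over S is attained *)
  (forall rho psi : 'M[R]_(nI, nT), (forall i t, 0 <= psi i t) ->
     exists2 W, S W & forall W', S W' ->
       inner_objective mu Q rho psi W' <= inner_objective mu Q rho psi W) /\
  is_minimum
    [set dual_objective S mu eta Q rho psi |
       rho in [set: 'M[R]_(nI, nT)] &
       psi in [set psi : 'M[R]_(nI, nT) | forall i t, 0 <= psi i t]]
    (worst_case_expectation S mu eta Q).
Proof.
move=> S Q.
have lo0 i t : 0 <= Wlo i t by have /andP[] := hbounds i t.
have S_ge0 W : S W -> forall i t, 0 <= W i t by move=> SW i t; have [] := SW i t.
have mQ : measurable_fun [set: demand_space R nI nT] Q.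
  exact: measurable_recourse.
have inner_max rho psi : exists2 W, S W & forall W', S W' ->
    inner_objective mu Q rho psi W' <= inner_objective mu Q rho psi W.
  apply: (@inner_objective_max _ _ _ _ _ _ _ (fun W => Q (posmx W))) => //.
    exact: continuous_recourse_posmx.
  by move=> W /S_ge0 /posmx_id ->.
split; first by move=> rho psi _; exact: inner_max.
have weak (rho psi : 'M[R]_(nI, nT)) : (forall i t, 0 <= psi i t) ->
    (worst_case_expectation S mu eta Q <= dual_objective S mu eta Q rho psi)%E.
  move=> psi0; have [W SW Wmax] := inner_max rho psi.
  apply: (@le_trans _ _ (\sum_(t < nT) \sum_(i < nI)
      (mu i t * rho i t + eta i t * psi i t) + inner_objective mu Q rho psi W)%:E).
    by apply: weak_duality => // V SV; apply: recourse_ge0 => //; exact: S_ge0.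
  by rewrite EFinD /dual_objective leeD2l//; apply: ereal_sup_ubound; exists W.
split; last by move=> _ [rho _ [psi psi0 <-]]; exact: weak.
have [|rho [psi [psi0 strong]]] := strong_duality lo0 hmu heta hgamma _ mQ.
  by move=> V V' SV SV'; apply: recourse_lipschitz => //; exact: S_ge0.
exists rho => //; exists psi => //; apply/eqP; rewrite eq_le weak// andbT.
have [W SW Wmax] := inner_max rho psi.
apply: le_trans (strong W SW).
rewrite EFinD /dual_objective leeD2l//; apply: ge_ereal_sup => _ [W' SW' <-].
by rewrite lee_fin Wmax.
Qed.
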